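(* Let $\Gamma$ be a commutative field extending $\mathbb{C}$ and let $\mathbb{K}$ be a subfield of $\Gamma$. If $X,Y \in \mathbb{C}^2$, $\psi_2(X,Y) \in \mathbb{Q}$ and $X \neq Y$, then there exists a finite set $S_{XY}$ with $\{X,Y\} \subseteq S_{XY} \subseteq \mathbb{C}^2$ such that any map $f: S_{XY} \to \mathbb{K}^2$ that preserves unit distance satisfies $\psi_2(X,Y)=\psi_2(f(X),f(Y))$ and $f(X) \neq f(Y)$.
   Context: The map $\psi_2: \Gamma^2 \times \Gamma^2 \to \Gamma$ is $\psi_2((x_1,x_2),(y_1,y_2)) = (x_1-y_1)^2+(x_2-y_2)^2$; it is applied to points of $\mathbb{C}^2 \subseteq \Gamma^2$ and of $\mathbb{K}^2\subseteq\Gamma^2$. For $S \subseteq \mathbb{C}^2$, a map $f: S \to \mathbb{K}^2$ preserves unit distance if $\psi_2(U,V)=1$ implies $\psi_2(f(U),f(V))=1$ for all $U,V \in S$. *)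

(* Defs.v *)
From mathcomp Require Import all_boot all_order all_algebra.
From mathcomp Require Import finmap reals complex.

Set Implicit Arguments.
Unset Strict Implicit.
Unset Printing Implicit Defensive.

Import GRing.Theory.
Local Open Scope ring_scope.

Definition psi2 (Gamma : fieldType) (x y : Gamma * Gamma) : Gamma :=
  (x.1 - y.1) ^+ 2 + (x.2 - y.2) ^+ 2.

(* The inclusion C^2 <= Gamma^2, for C embedded in Gamma by the (necessarily
   injective) field morphism iota. *)
Definition plane_incl (R : realType) (Gamma : fieldType)
    (iota : {rmorphism R[i] -> Gamma}) (U : R[i] * R[i]) : Gamma * Gamma :=
  (iota U.1, iota U.2).

(* A map S -> K^2 is represented by a total function whose values outside S
   are irrelevant; K is a subfield of Gamma, given by its carrier. *)
Definition maps_to_plane (R : realType) (Gamma : fieldType)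
    (K : divringClosed Gamma) (S : {fset R[i] * R[i]})
    (f : R[i] * R[i] -> Gamma * Gamma) : Prop :=
  forall U, U \in S -> (f U).1 \in K /\ (f U).2 \in K.

Definition preserves_unit_distance (R : realType) (Gamma : fieldType)
    (iota : {rmorphism R[i] -> Gamma}) (S : {fset R[i] * R[i]})
    (f : R[i] * R[i] -> Gamma * Gamma) : Prop :=
  forall U V, U \in S -> V \in S ->
    psi2 (plane_incl iota U) (plane_incl iota V) = 1 -> psi2 (f U) (f V) = 1.

(* Main.v *)
Require Import Defs.
From mathcomp Require Import all_boot all_order all_algebra.
From mathcomp Require Import finmap reals complex.
From mathcomp Require Import ring.

Set Implicit Arguments.
Unset Strict Implicit.
Unset Printing Implicit Defensive.

Import GRing.Theory Num.Theory.
Local Open Scope ring_scope.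

(** Call a property of maps forced if some finite set of points makes every
unit-distance preserving map on it satisfy the property.  Forced properties
are closed under conjunction and consequence, so the theorem becomes a matter
of enlarging the set of values r such that psi2 X Y = r forces the images of
X and Y to be at psi2-value r as well (preserved r).

The basic figure is a kite: two points B, C with psi2 B C = b and two distinct
apexes A, A' with all four sides of value a, so that psi2 A A' = 4a - b.  In
the target plane an apex over a non-isotropic base is unique up to reflection
(apex_unique_up_to_reflection), so the images of A and A' either coincide or
keep the value 4a - b.  A Moser spindle, two such kites sharing A whose far
apexes are at unit distance, excludes coincidence.  Hence preserved values are
closed under (a, b) |-> 4a - b (preserved_kite); all the triangles used exist
because complex numbers have square roots (triangle_exists).

From a = b one obtains 3r, then rigid rhombi of value r, then rigid midpoints
(midpoint_forced), whence 4r is preserved with r.  Iterated midpoints make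
unit arithmetic progressions rigid, and enlarging an isosceles triangle with
unit legs by a factor n shows that r is preserved as soon as n^2 r is
(preserved_div_sqr).  Combining these, 4a - 4c = 2^2 (a - c) gives closure
under nonzero differences, starting from 1 and 3: this yields 2, then -1, then
all nonzero integers m, and finally m/n = (m n)/n^2.

The value 0 needs a separate argument, as distinct X, Y with psi2 X Y = 0 could
a priori be identified.  There is a point Z with psi2 X Z = 1 and
psi2 Y Z = -1; the difference of these values separates the images of X and Y.
Reflecting Z in Y, the median identity expresses psi2 X Y through nonzero
preserved values (isotropic_forced). *)

(** * The form psi2 over an arbitrary field *)

Section PlaneGeometry.
Variable F : fieldType.
Implicit Types A B C D X Y Z W : F * F.

Lemma pair_addE A B C D :
  A + B = C + D -> A.1 + B.1 = C.1 + D.1 /\ A.2 + B.2 = C.2 + D.2.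
Proof. by case: A B C D => [? ?] [? ?] [? ?] [? ?] []. Qed.

Lemma psi2C X Y : psi2 X Y = psi2 Y X.
Proof. rewrite /psi2; ring. Qed.

Lemma psi2xx X : psi2 X X = 0.
Proof. rewrite /psi2; ring. Qed.

Lemma psi2_neq X Y : psi2 X Y != 0 -> X <> Y.
Proof. by move=> nz eXY; rewrite eXY psi2xx eqxx in nz. Qed.

Lemma psi2_mulrn X Y X' Y' n :
  X' - Y' = (X - Y) *+ n -> psi2 X' Y' = n%:R ^+ 2 * psi2 X Y.
Proof.
move=> e.
have e1 : X'.1 - Y'.1 = (X.1 - Y.1) *+ n by have := congr1 fst e; rewrite raddfMn.
have e2 : X'.2 - Y'.2 = (X.2 - Y.2) *+ n by have := congr1 snd e; rewrite raddfMn.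
by rewrite /psi2 e1 e2 -natrX mulr_natl !exprMn_n -mulrnDl.
Qed.

Lemma psi2_opposite_sides A A' B C : A + A' = B + C -> psi2 A' B = psi2 A C.
Proof.
move=> /pair_addE[e1 e2]; rewrite /psi2.
have -> : A'.1 = B.1 + C.1 - A.1 by rewrite -e1; ring.
have -> : A'.2 = B.2 + C.2 - A.2 by rewrite -e2; ring.
ring.
Qed.

Lemma parallelogram_law A A' B C : A + A' = B + C ->
  psi2 A A' + psi2 B C = 2 * (psi2 A B + psi2 A C).
Proof.
move=> /pair_addE[e1 e2]; rewrite /psi2.
have -> : A'.1 = B.1 + C.1 - A.1 by rewrite -e1; ring.
have -> : A'.2 = B.2 + C.2 - A.2 by rewrite -e2; ring.
ring.
Qed.

(** Apollonius' theorem; it determines psi2 X Y from nonzero values even when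
psi2 X Y = 0. *)
Lemma median_law X Z W Y : Z + W = Y + Y ->
  psi2 X Z + psi2 X W = 2 * (psi2 X Y + psi2 Y Z).
Proof.
move=> /pair_addE[e1 e2]; rewrite /psi2.
have -> : W.1 = Y.1 + Y.1 - Z.1 by rewrite -e1; ring.
have -> : W.2 = Y.2 + Y.2 - Z.2 by rewrite -e2; ring.
ring.
Qed.

(** Relative to the midpoint of B and C, both apexes are orthogonal to the
direction of the base and have the same norm.  The orthogonal of a
non-isotropic vector is a line without isotropic vectors, so the two apexes
agree up to sign. *)
Lemma apex_unique_up_to_reflection A A' B C a : (2 : F) != 0 -> psi2 B C != 0 ->
  psi2 A B = a -> psi2 A C = a -> psi2 A' B = a -> psi2 A' C = a ->
  A = A' \/ A + A' = B + C.
Proof.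
case: A A' B C => [a1 a2] [a1' a2'] [b1 b2] [c1 c2]; rewrite /psi2 /=.
move=> nz2 nzb eB eC eB' eC'.
pose v1 := c1 - b1; pose v2 := c2 - b2.
have nzv : v1 ^+ 2 + v2 ^+ 2 != 0.
  by have -> : v1 ^+ 2 + v2 ^+ 2 = (b1 - c1) ^+ 2 + (b2 - c2) ^+ 2
    by rewrite /v1 /v2; ring.
(* a vector orthogonal to the non-isotropic vector (v1, v2), and with zero
   determinant against it, vanishes *)
have vanish x1 x2 : x1 * v1 + x2 * v2 = 0 -> x1 * v2 - x2 * v1 = 0 ->
    x1 = 0 /\ x2 = 0.
  move=> dot0 det0; split; apply: (mulfI nzv); rewrite mulr0.
    have -> : (v1 ^+ 2 + v2 ^+ 2) * x1 =
      v1 * (x1 * v1 + x2 * v2) + v2 * (x1 * v2 - x2 * v1) by ring.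
    by rewrite dot0 det0 !mulr0 addr0.
  have -> : (v1 ^+ 2 + v2 ^+ 2) * x2 =
    v2 * (x1 * v1 + x2 * v2) - v1 * (x1 * v2 - x2 * v1) by ring.
  by rewrite dot0 det0 !mulr0 subr0.
(* twice the positions of the apexes relative to the midpoint of the base *)
pose x1 := 2 * a1 - b1 - c1; pose x2 := 2 * a2 - b2 - c2.
pose y1 := 2 * a1' - b1 - c1; pose y2 := 2 * a2' - b2 - c2.
have dx : x1 * v1 + x2 * v2 = 0.
  have -> : x1 * v1 + x2 * v2 = (a1 - b1) ^+ 2 + (a2 - b2) ^+ 2 -
     ((a1 - c1) ^+ 2 + (a2 - c2) ^+ 2) by rewrite /x1 /x2 /v1 /v2; ring.
  by rewrite eB eC subrr.
have dy : y1 * v1 + y2 * v2 = 0.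
  have -> : y1 * v1 + y2 * v2 = (a1' - b1) ^+ 2 + (a2' - b2) ^+ 2 -
     ((a1' - c1) ^+ 2 + (a2' - c2) ^+ 2) by rewrite /y1 /y2 /v1 /v2; ring.
  by rewrite eB' eC' subrr.
have nx : x1 ^+ 2 + x2 ^+ 2 = 4 * a - (v1 ^+ 2 + v2 ^+ 2).
  have -> : x1 ^+ 2 + x2 ^+ 2 = 2 * ((a1 - b1) ^+ 2 + (a2 - b2) ^+ 2) +
     2 * ((a1 - c1) ^+ 2 + (a2 - c2) ^+ 2) - (v1 ^+ 2 + v2 ^+ 2)
    by rewrite /x1 /x2 /v1 /v2; ring.
  by rewrite eB eC; ring.
have ny : y1 ^+ 2 + y2 ^+ 2 = 4 * a - (v1 ^+ 2 + v2 ^+ 2).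
  have -> : y1 ^+ 2 + y2 ^+ 2 = 2 * ((a1' - b1) ^+ 2 + (a2' - b2) ^+ 2) +
     2 * ((a1' - c1) ^+ 2 + (a2' - c2) ^+ 2) - (v1 ^+ 2 + v2 ^+ 2)
    by rewrite /y1 /y2 /v1 /v2; ring.
  by rewrite eB' eC'; ring.
(* by Lagrange's identity the squared determinant depends only on the norms
   and the scalar product *)
have sqr_det : (x1 * v2 - x2 * v1) ^+ 2 = (y1 * v2 - y2 * v1) ^+ 2.
  have -> : (x1 * v2 - x2 * v1) ^+ 2 = (x1 ^+ 2 + x2 ^+ 2) * (v1 ^+ 2 + v2 ^+ 2)
     - (x1 * v1 + x2 * v2) ^+ 2 by ring.
  have -> : (y1 * v2 - y2 * v1) ^+ 2 = (y1 ^+ 2 + y2 ^+ 2) * (v1 ^+ 2 + v2 ^+ 2)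
     - (y1 * v1 + y2 * v2) ^+ 2 by ring.
  by rewrite nx ny dx dy.
have /orP[/eqP det_eq|/eqP det_opp] :
    (x1 * v2 - x2 * v1 == y1 * v2 - y2 * v1) ||
    (x1 * v2 - x2 * v1 == - (y1 * v2 - y2 * v1)) by rewrite -eqf_sqr sqr_det.
- have [] := vanish (x1 - y1) (x2 - y2).
  + have -> : (x1 - y1) * v1 + (x2 - y2) * v2 =
      (x1 * v1 + x2 * v2) - (y1 * v1 + y2 * v2) by ring.
    by rewrite dx dy subrr.
  + have -> : (x1 - y1) * v2 - (x2 - y2) * v1 =
      (x1 * v2 - x2 * v1) - (y1 * v2 - y2 * v1) by ring.
    by rewrite det_eq subrr.
  move=> z1 z2; left; congr (_, _); apply: (mulfI nz2); apply/eqP;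
    rewrite -subr_eq0; apply/eqP.
  + by rewrite -z1 /x1 /y1; ring.
  + by rewrite -z2 /x2 /y2; ring.
- have [] := vanish (x1 + y1) (x2 + y2).
  + have -> : (x1 + y1) * v1 + (x2 + y2) * v2 =
      (x1 * v1 + x2 * v2) + (y1 * v1 + y2 * v2) by ring.
    by rewrite dx dy addr0.
  + have -> : (x1 + y1) * v2 - (x2 + y2) * v1 =
      (x1 * v2 - x2 * v1) + (y1 * v2 - y2 * v1) by ring.
    by rewrite det_opp addNr.
  move=> z1 z2; right; congr (_, _); apply: (mulfI nz2); apply/eqP;
    rewrite -subr_eq0; apply/eqP.
  + by rewrite /= -z1 /x1 /y1; ring.
  + by rewrite /= -z2 /x2 /y2; ring.
Qed.

End PlaneGeometry.

(** * Existence of configurations over the complex numbers *)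

Section ComplexPlane.
Variable C : numClosedFieldType.
Implicit Types X Y Z : C * C.

(** Without order there is no triangle inequality: the foot of the altitude is
prescribed by a linear equation, and its height by a square root. *)
Lemma triangle_exists X Y (s t : C) : psi2 X Y != 0 ->
  exists Z, psi2 X Z = s /\ psi2 Y Z = t.
Proof.
case: X Y => [x1 x2] [y1 y2]; rewrite /psi2 /= => nz.
have nz2 : (2 : C) != 0 by rewrite pnatr_eq0.
set r := _ + _ in nz.
(* position p of the foot along X Y, and height h, both in units of X Y *)
pose p := (1 - (t - s) / r) / 2; pose h := 2.-root (s / r - p ^+ 2).
have hK : h ^+ 2 = s / r - p ^+ 2 by rewrite sqrtCK.
pose w1 := y1 - x1; pose w2 := y2 - x2.
have rE : w1 ^+ 2 + w2 ^+ 2 = r by rewrite /r /w1 /w2; ring.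
exists (x1 + p * w1 - h * w2, x2 + p * w2 + h * w1); split=> /=.
- transitivity ((p ^+ 2 + h ^+ 2) * (w1 ^+ 2 + w2 ^+ 2)); first by ring.
  by rewrite hK rE; field.
- transitivity ((1 - 2 * p + p ^+ 2 + h ^+ 2) * (w1 ^+ 2 + w2 ^+ 2)).
    by rewrite /w1 /w2; ring.
  by rewrite hK rE /p; field; rewrite nz.
Qed.

(** An isotropic vector is not orthogonal to the whole plane, so the two values
can differ even though X and Y are at value 0. *)
Lemma isotropic_witness X Y : X <> Y -> psi2 X Y = 0 ->
  exists Z, psi2 X Z = 1 /\ psi2 Y Z = -1.
Proof.
case: X Y => [x1 x2] [y1 y2]; rewrite /psi2 /= => neqXY.
pose u1 := y1 - x1; pose u2 := y2 - x2 => iso.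
have nz2 : (2 : C) != 0 by rewrite pnatr_eq0.
have e : u2 ^+ 2 = - u1 ^+ 2.
  by apply/eqP; rewrite -addr_eq0; apply/eqP; rewrite -iso /u1 /u2; ring.
have nz1 : u1 != 0.
  apply/eqP => z1; have /eqP := e; rewrite z1 expr0n oppr0 sqrf_eq0 => /eqP z2.
  by apply: neqXY; congr (_, _); apply/esym/eqP; rewrite -subr_eq0; apply/eqP.
pose c := (2 * u1 ^+ 2)^-1.
have cE : c * u1 ^+ 2 = 2^-1 by rewrite /c; field; rewrite nz1.
(* With u = Y - X and u' = (u1, - u2), the conditions on z = Z - X are
   z.z = 1 and z.u = 1.  As u and u' are isotropic with u.u' = 2 u1^2, they
   are met by z = u / 2 + c u'. *)
exists (x1 + (2^-1 + c) * u1, x2 + (2^-1 - c) * u2); split=> /=.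
- transitivity ((2^-1 + c) ^+ 2 * u1 ^+ 2 + (2^-1 - c) ^+ 2 * u2 ^+ 2).
    by ring.
  rewrite e; transitivity (4 * 2^-1 * (c * u1 ^+ 2)); first by ring.
  by rewrite cE; field.
- transitivity ((c - 2^-1) ^+ 2 * u1 ^+ 2 + (2^-1 + c) ^+ 2 * u2 ^+ 2).
    by rewrite /u1 /u2; field.
  rewrite e; transitivity (- (4 * 2^-1 * (c * u1 ^+ 2))); first by ring.
  by rewrite cE; field.
Qed.

End ComplexPlane.

(** * Properties forced by finite sets of points *)

Section UnitPreservingMaps.
Variables (R : realType) (Gamma : fieldType) (iota : {rmorphism R[i] -> Gamma}).
Implicit Types (A B C D X Y Z W : R[i] * R[i]) (a b r : R[i]).
Implicit Types (f : R[i] * R[i] -> Gamma * Gamma).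

Definition forced (E : (R[i] * R[i] -> Gamma * Gamma) -> Prop) : Prop :=
  exists S : {fset R[i] * R[i]},
    forall f, preserves_unit_distance iota S f -> E f.

(** For r = 0 this would allow the images of distinct points to coincide; it
    is the right notion only for nonzero values, where equality of values
    already separates the images. *)
Definition preserved r : Prop :=
  forall X Y, psi2 X Y = r -> forced (fun f => psi2 (f X) (f Y) = iota r).

Lemma natr_neq0 n : (n.+1%:R : Gamma) != 0.
Proof. by rewrite -(rmorph_nat iota) fmorph_eq0 pnatr_eq0. Qed.

Lemma psi2_plane_incl X Y :
  psi2 (plane_incl iota X) (plane_incl iota Y) = iota (psi2 X Y).
Proof. by rewrite /psi2 /plane_incl /= -!rmorphB -!rmorphXn -rmorphD. Qed.

Lemma forced_mono E E' : (forall f, E f -> E' f) -> forced E -> forced E'.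
Proof. by move=> sub [S hS]; exists S => f /hS /sub. Qed.

Lemma forced_and E E' : forced E -> forced E' -> forced (fun f => E f /\ E' f).
Proof.
move=> [S hS] [S' hS']; exists (S `|` S')%fset => f hf; split.
- by apply: hS => U V US VS; apply: hf; rewrite in_fsetU ?US ?VS.
- by apply: hS' => U V US VS; apply: hf; rewrite in_fsetU ?US ?VS orbT.
Qed.

Lemma preserved1 : preserved 1.
Proof.
move=> X Y eXY; exists [fset X; Y]%fset => f hf; rewrite rmorph1.
by apply: hf; rewrite ?in_fset2 ?eqxx ?orbT // psi2_plane_incl eXY rmorph1.
Qed.

(** The kite in the source is carried to two apexes over one base in the target,
where the degenerate alternative of a folded kite remains. *)
Lemma kite_forced a b A A' B C : preserved a -> preserved b -> b != 0 ->
  A + A' = B + C -> psi2 A B = a -> psi2 A C = a -> psi2 B C = b ->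
  forced (fun f => f A = f A' \/ f A + f A' = f B + f C).
Proof.
move=> Pa Pb nzb par eAB eAC eBC.
have eA'B : psi2 A' B = a by rewrite (psi2_opposite_sides par).
have eA'C : psi2 A' C = a.
  by rewrite (psi2_opposite_sides (etrans par (addrC B C))).
have := forced_and (forced_and (Pa _ _ eAB) (Pa _ _ eAC))
  (forced_and (Pb _ _ eBC) (forced_and (Pa _ _ eA'B) (Pa _ _ eA'C))).
apply: forced_mono => f [[fAB fAC] [fBC [fA'B fA'C]]].
apply: apex_unique_up_to_reflection fAB fAC fA'B fA'C; first exact: natr_neq0.
by rewrite fBC fmorph_eq0.
Qed.

(** Every pair at value 4a - b is the axis of a kite with sides a and base b;
the parallelogram law in the target then computes the unfolded value. *)
Lemma kite_alternative a b A A' : preserved a -> preserved b -> b != 0 ->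
  4 * a - b != 0 -> psi2 A A' = 4 * a - b ->
  forced (fun f => f A = f A' \/ psi2 (f A) (f A') = iota (4 * a - b)).
Proof.
move=> Pa Pb nzb nzr eAA'.
have [B [eAB eA'B]] : exists B, psi2 A B = a /\ psi2 A' B = a.
  by apply: triangle_exists; rewrite eAA'.
pose C := A + A' - B.
have par : A + A' = B + C by rewrite /C subrKC.
have eAC : psi2 A C = a by rewrite -(psi2_opposite_sides par).
have eBC : psi2 B C = b.
  by apply: (@addrI _ (4 * a - b)); rewrite -{1}eAA' (parallelogram_law par)
    eAB eAC; ring.
have := forced_and (kite_forced Pa Pb nzb par eAB eAC eBC)
  (forced_and (Pa _ _ eAB) (forced_and (Pa _ _ eAC) (Pb _ _ eBC))).
apply: forced_mono => f [[fAA'|fpar] [fAB [fAC fBC]]]; [by left|right].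
apply: (@addIr _ (iota b)); rewrite -{1}fBC (parallelogram_law fpar) fAB fAC.
by rewrite -rmorphD -rmorphD -(rmorph_nat iota 2) -rmorphM; congr (iota _); ring.
Qed.

(** Moser's spindle: A2 is at value 4a - b from A and at unit distance from A'.
If the images of A and A' coincided, their value to the image of A2 would be
both 1 and one of 0, 4a - b.  The case 4a - b = 1 is the hypothesis itself. *)
Lemma preserved_kite a b : preserved a -> preserved b -> b != 0 ->
  4 * a - b != 0 -> preserved (4 * a - b).
Proof.
move=> Pa Pb nzb nzr A A' eAA'.
have [r1|r_neq1] := eqVneq (4 * a - b) 1.
  by rewrite r1; apply: preserved1; rewrite eAA'.
have [A2 [eAA2 eA'A2]] :
    exists A2, psi2 A A2 = 4 * a - b /\ psi2 A' A2 = 1.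
  by apply: triangle_exists; rewrite eAA'.
have := forced_and (kite_alternative Pa Pb nzb nzr eAA')
  (forced_and (kite_alternative Pa Pb nzb nzr eAA2) (preserved1 eA'A2)).
apply: forced_mono => f [[fAA'|//] [fAA2 fA'A2]].
rewrite -fAA' rmorph1 in fA'A2; case: fAA2 => [fAA2|fAA2].
  by move/eqP: fA'A2; rewrite fAA2 psi2xx eq_sym oner_eq0.
by move/eqP: r_neq1; case; apply: (fmorph_inj iota); rewrite -fAA2 fA'A2 rmorph1.
Qed.

(** * Rigid rhombi, midpoints and progressions *)

Lemma preserved3 r : preserved r -> r != 0 -> preserved (3 * r).
Proof.
have -> : 3 * r = 4 * r - r by ring.
move=> Pr nzr; apply: preserved_kite => //.
have -> : 4 * r - r = 3 * r by ring.
by rewrite mulf_neq0 ?pnatr_eq0.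
Qed.

(** The long diagonal has the nonzero preserved value 3r, which rules out the
folded rhombus. *)
Lemma rhombus_forced r A A' B C : preserved r -> r != 0 ->
  A + A' = B + C -> psi2 A B = r -> psi2 A C = r -> psi2 B C = r ->
  forced (fun f => f A + f A' = f B + f C).
Proof.
move=> Pr nzr par eAB eAC eBC.
have eAA' : psi2 A A' = 3 * r.
  by apply: (@addIr _ r); rewrite -{1}eBC (parallelogram_law par) eAB eAC; ring.
have := forced_and (kite_forced Pr Pr nzr par eAB eAC eBC)
  (preserved3 Pr nzr eAA').
apply: forced_mono => f [[fAA'|//] /eqP].
rewrite fAA' psi2xx eq_sym fmorph_eq0 mulf_eq0 (negPf nzr) orbF.
by rewrite pnatr_eq0.
Qed.

(** Two equilateral rhombi A B E D and D B C E of the triangular lattice, sharing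
the triangle B D E: adding their parallelogram relations cancels the points off the
line. *)
Lemma midpoint_forced r A B C : preserved r -> r != 0 ->
  A + C = B + B -> psi2 A B = r -> forced (fun f => f A + f C = f B + f B).
Proof.
move=> Pr nzr mid eAB.
have [D [eAD eBD]] : exists D, psi2 A D = r /\ psi2 B D = r.
  by apply: triangle_exists; rewrite eAB.
pose E := B + D - A.
have parA : A + E = B + D by rewrite /E subrKC.
have parD : D + C = B + E.
  by rewrite /E; apply: (@addrI _ A); rewrite addrCA mid [RHS]addrCA subrKC addrC -addrA.
have eDE : psi2 D E = r.
  by rewrite psi2C (psi2_opposite_sides (etrans parA (addrC B D))).
have eBE : psi2 B E = r by rewrite psi2C (psi2_opposite_sides parA).
have := forced_and (rhombus_forced Pr nzr parA eAB eAD eBD)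
  (rhombus_forced Pr nzr parD (etrans (psi2C D B) eBD) eDE eBE).
apply: forced_mono => f [fA fD].
apply: (@addrI _ (f D)); rewrite addrCA fD addrCA fA addrCA.
by rewrite addrA addrC.
Qed.

(** Each term after the second is determined by the two preceding ones, through
the midpoint relation. *)
Lemma progression_forced A v n : psi2 A (A + v) = 1 ->
  forced (fun f => f (A + v *+ n) - f A = (f (A + v) - f A) *+ n).
Proof.
move=> unit_v.
suff : forced (fun f => f (A + v *+ n) - f A = (f (A + v) - f A) *+ n /\
    f (A + v *+ n.+1) - f A = (f (A + v) - f A) *+ n.+1).
  by apply: forced_mono => f [].
elim: n => [|n IHn].
  by exists fset0 => f _; rewrite !mulr0n addr0 subrr.
have mid : (A + v *+ n) + (A + v *+ n.+2) = (A + v *+ n.+1) + (A + v *+ n.+1).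
  by rewrite addrACA [RHS]addrACA -!mulrnDr addnS addSn.
have unit_step : psi2 (A + v *+ n) (A + v *+ n.+1) = 1.
  rewrite -unit_v (@psi2_mulrn _ A (A + v) _ _ 1) ?expr1n ?mul1r //.
  have dropl (x y : R[i] * R[i]) : x - (x + y) = - y.
    by rewrite opprD addrA subrr sub0r.
  by rewrite mulr1n mulrSr addrA !dropl.
have := forced_and IHn
  (midpoint_forced preserved1 (oner_neq0 _) mid unit_step).
apply: forced_mono => f [[fn fn1] fmid]; split=> //.
apply: (@addrI _ (f (A + v *+ n) - f A)); rewrite addrACA fmid.
by rewrite addrACA fn1 fn -!mulrnDr addSnnS.
Qed.

Lemma preserved_mul4 r : preserved r -> r != 0 -> preserved (4 * r).
Proof.
move=> Pr nzr X Y eXY.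
pose B : R[i] * R[i] := ((X.1 + Y.1) / 2, (X.2 + Y.2) / 2).
have nz2 : (2 : R[i]) != 0 by rewrite pnatr_eq0.
have mid : X + Y = B + B by congr (_, _); rewrite /=; field.
have eXB : psi2 X B = r.
  have nz4 : (4 : R[i]) != 0 by rewrite pnatr_eq0.
  by apply: (mulfI nz4); rewrite -eXY /psi2 /=; field.
have := forced_and (midpoint_forced Pr nzr mid eXB) (Pr _ _ eXB).
apply: forced_mono => f [fmid fXB].
have := parallelogram_law fmid; rewrite psi2xx addr0 fXB => ->.
by rewrite rmorphM rmorph_nat; ring.
Qed.

(** X and Y are the feet of an isosceles triangle with unit legs and apex Z.
Its enlargement by n + 1 from Z has base of value (n + 1)^2 r, and the legs
are rigid progressions, so the image is enlarged by the same factor. *)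
Lemma preserved_div_sqr r n : r != 0 -> preserved (n.+1%:R ^+ 2 * r) ->
  preserved r.
Proof.
move=> nzr Pnr X Y eXY.
have [Z [eXZ eYZ]] : exists Z, psi2 X Z = 1 /\ psi2 Y Z = 1.
  by apply: triangle_exists; rewrite eXY.
have unitX : psi2 Z (Z + (X - Z)) = 1 by rewrite subrKC psi2C.
have unitY : psi2 Z (Z + (Y - Z)) = 1 by rewrite subrKC psi2C.
have := forced_and (progression_forced n.+1 unitX)
  (progression_forced n.+1 unitY).
set X' := Z + _ *+ _; set Y' := Z + (Y - Z) *+ _.
have big : X' - Y' = (X - Y) *+ n.+1.
  by rewrite /X' /Y' opprD addrACA subrr add0r -mulrnBl opprB addrA subrK.
have eX'Y' : psi2 X' Y' = n.+1%:R ^+ 2 * r by rewrite (psi2_mulrn big) eXY.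
rewrite !subrKC => /forced_and /(_ (Pnr _ _ eX'Y')).
apply: forced_mono => f [[fX fY] fX'Y'].
have fbig : f X' - f Y' = (f X - f Y) *+ n.+1.
  transitivity ((f X' - f Z) - (f Y' - f Z)); first by rewrite opprB addrA subrK.
  by rewrite fX fY -mulrnBl opprB addrA subrK.
have nzn : (n.+1%:R ^+ 2 : Gamma) != 0 by rewrite expf_neq0 ?natr_neq0.
apply: (mulfI nzn); rewrite -(psi2_mulrn fbig) fX'Y'.
by rewrite rmorphM rmorphXn rmorph_nat.
Qed.

(** * All nonzero rational values are preserved *)

(** 4a - 4c is the value of a kite with base 4c, and is 2^2 (a - c). *)
Lemma preserved_sub a c : preserved a -> preserved c -> c != 0 -> a != c ->
  preserved (a - c).
Proof.
move=> Pa Pc nzc neq.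
have nz4 : (4 : R[i]) != 0 by rewrite pnatr_eq0.
apply: (@preserved_div_sqr _ 1); first by rewrite subr_eq0.
have -> : 2 ^+ 2 * (a - c) = 4 * a - 4 * c by ring.
apply: preserved_kite => //; first exact: preserved_mul4.
- by rewrite mulf_neq0.
- by rewrite -mulrBr mulf_neq0 ?subr_eq0.
Qed.

Lemma preservedN1 : preserved (-1).
Proof.
have P2 : preserved 2.
  have -> : 2 = 3 * 1 - 1 :> R[i] by ring.
  apply: preserved_sub; rewrite ?oner_neq0 ?mulr1 //.
  - by have := preserved3 preserved1 (oner_neq0 _); rewrite mulr1.
  - exact: preserved1.
  - by rewrite (eqr_nat _ 3 1).
have -> : -1 = 1 - 2 :> R[i] by ring.
apply: preserved_sub => //; first exact: preserved1.
- by rewrite pnatr_eq0.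
- by rewrite (eqr_nat _ 1 2).
Qed.

Lemma preserved_nat n : preserved n.+1%:R.
Proof.
elim: n => [|n IHn]; first exact: preserved1.
have -> : n.+2%:R = n.+1%:R - (-1) :> R[i] by rewrite opprK natr1.
apply: preserved_sub => //; first exact: preservedN1.
- by rewrite oppr_eq0 oner_neq0.
- by rewrite -addr_eq0 natr1 pnatr_eq0.
Qed.

Lemma preserved_int (m : int) : m != 0 -> preserved m%:~R.
Proof.
case: m => [[//|n]|n] _; first exact: preserved_nat.
have -> : (Negz n)%:~R = 1 - n.+2%:R :> R[i].
  by rewrite NegzE rmorphN /= -[n.+2%:R]natr1 opprD addrCA subrr addr0.
apply: preserved_sub; [exact: preserved1|exact: preserved_nat|..].
- by rewrite pnatr_eq0.
- by rewrite (eqr_nat _ 1 n.+2).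
Qed.

Lemma preserved_rat (q : rat) : q != 0 -> preserved (ratr q).
Proof.
move=> nzq; case dE: (denq q) (denq_gt0 q) => [[//|n]|//] _.
apply: (@preserved_div_sqr _ n); first by rewrite fmorph_eq0.
have -> : n.+1%:R ^+ 2 * ratr q = (numq q * n.+1%:Z)%:~R :> R[i].
  have nzn : (n.+1%:R : R[i]) != 0 by rewrite pnatr_eq0.
  rewrite /ratr dE rmorphM /= -pmulrn; move: (n.+1%:R : R[i]) nzn => d nzd.
  by field.
by apply: preserved_int; rewrite mulf_neq0 // numq_eq0.
Qed.

(** * Distinct points at value zero *)

Lemma isotropic_forced X Y : X <> Y -> psi2 X Y = 0 ->
  forced (fun f => psi2 (f X) (f Y) = 0 /\ f X <> f Y).
Proof.
move=> neqXY eXY; have [Z [eXZ eYZ]] := isotropic_witness neqXY eXY.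
have nzN1 : (-1 : R[i]) != 0 by rewrite oppr_eq0 oner_neq0.
pose W := Y + Y - Z.
have mid : Z + W = Y + Y by rewrite /W subrKC.
have P3 : preserved (-3) by apply: (@preserved_int (-3)).
have eXW : psi2 X W = -3.
  apply: (@addrI _ 1); rewrite -{1}eXZ (median_law X mid) eXY eYZ; ring.
have := forced_and
  (forced_and (preserved1 eXZ) (preservedN1 eYZ))
  (forced_and (P3 _ _ eXW)
    (midpoint_forced preservedN1 nzN1 mid (etrans (psi2C Z Y) eYZ))).
apply: forced_mono => f [[fXZ fYZ] [fXW fmid]].
rewrite rmorph1 in fXZ; rewrite rmorphN1 in fYZ.
rewrite rmorphN rmorph_nat in fXW.
have nz2 : (2 : Gamma) != 0 := natr_neq0 1.
split.
- have := median_law (f X) fmid; rewrite fXZ fXW fYZ => e.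
  apply: (mulfI nz2); rewrite mulr0.
  transitivity (2 * (psi2 (f X) (f Y) + -1) + 2); first by ring.
  by rewrite -e; ring.
- move=> fXY; have /eqP := fXZ; rewrite fXY fYZ -subr_eq0 -opprD oppr_eq0.
  by rewrite (negPf nz2).
Qed.

End UnitPreservingMaps.

Theorem theorem3 (R : realType) (Gamma : fieldType)
    (iota : {rmorphism R[i] -> Gamma}) (K : divringClosed Gamma)
    (X Y : R[i] * R[i])
    (hQ : exists q : rat,
        psi2 (plane_incl iota X) (plane_incl iota Y) = ratr q)
    (hXY : X <> Y) :
  exists S : {fset R[i] * R[i]},
    [/\ X \in S, Y \in S &
      forall f : R[i] * R[i] -> Gamma * Gamma,
        maps_to_plane K S f ->
        preserves_unit_distance iota S f ->
        psi2 (plane_incl iota X) (plane_incl iota Y) = psi2 (f X) (f Y)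
        /\ f X <> f Y].
Proof.
case: hQ => q; rewrite psi2_plane_incl -(fmorph_rat iota) => /fmorph_inj eXY.
have [S hS] : forced iota
    (fun f => iota (psi2 X Y) = psi2 (f X) (f Y) /\ f X <> f Y).
  have [q0|nzq] := eqVneq q 0.
    have e0 : psi2 X Y = 0 by rewrite eXY q0 rmorph0.
    apply: forced_mono (isotropic_forced iota hXY e0) => f [fXY neq].
    by rewrite e0 rmorph0 fXY.
  apply: forced_mono (preserved_rat iota nzq eXY) => f fXY.
  rewrite eXY fXY; split=> //; apply: psi2_neq.
  by rewrite fXY !fmorph_eq0.
exists (S `|` [fset X; Y])%fset; split.
- by rewrite !inE eqxx orbT.
- by rewrite !inE eqxx !orbT.
move=> f _ hf; apply: hS => U V US VS; apply: hf; rewrite in_fsetU ?US ?VS //.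
Qed.
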